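(* Let $S,S_1,S_0\subset\mathbf P^3$ be the sets of foci of singular lines of the non-singular quadratic line complexes $\mathcal X=G\cap Q$, $\mathcal X_1=G\cap Q_1$, $\mathcal X_0=G\cap Q_0$ respectively (all defined in the context). (a) The surface $S$ is given by the equation $$(a_1+a_2)^2(c_3x^2y^2+d_3z^2t^2)+(a_1+a_3)^2(c_2x^2z^2+d_2y^2t^2)+(a_2+a_3)^2(c_1x^2t^2+d_1y^2z^2)+(a_1+a_2)(a_2+a_3)(a_3+a_1)xyzt=0.$$ (b) The surface $S_1$ is given by the equation $$b_3^2c_1x^4+b_2^2d_1y^4+b_1^2d_1z^4+b_4^2c_1t^4$$ $$+(b_3^2d_2+b_2^2c_2+(a_1+a_2)^2c_3+(a_1+a_2)b_2b_3)x^2y^2+(b_3^2d_3+b_1^2c_3+(a_1+a_2)^2c_2+(a_1+a_2)b_1b_3)x^2z^2$$ $$+(b_2^2d_3+b_4^2c_3+(a_1+a_2)^2d_2+(a_1+a_2)b_2b_4)y^2t^2+(b_1^2d_2+b_4^2c_2+(a_1+a_2)^2d_3+(a_1+a_2)b_1b_4)z^2t^2$$ $$+(a_1+a_2)^2(b_3x^2yz+b_2xy^2t+b_1xz^2t+b_4yzt^2)=0.$$ (c) The surface $S_0$ is given by the equation $$(b_3^2c_1+b_7^2c_3)x^4+(b_2^2d_1+b_8^2c_3)y^4+(b_1^2d_1+b_6^2d_3)z^4+(b_4^2c_1+b_5^2d_3)t^4$$ $$+b_5(b_1b_5+b_4b_7)xt^3+b_7(b_2b_7+b_3b_5)x^3t+b_2(b_2b_6+b_3b_8)xy^3+b_8(b_2b_6+b_3b_8)y^3z$$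 $$+b_3(b_2b_7+b_3b_5)x^3y+b_4(b_1b_5+b_4b_7)zt^3+b_6(b_1b_8+b_4b_6)yz^3+b_1(b_1b_8+b_4b_6)z^3t$$ $$+(b_2^2c_2+b_3^2d_2)x^2y^2+(b_1^2c_3+b_3^2d_3+b_6^2c_1+b_7^2d_1)x^2z^2+(b_5^2c_2+b_7^2d_2)x^2t^2$$ $$+(b_6^2d_2+b_8^2c_2)y^2z^2+(b_2^2d_3+b_4^2c_3+b_5^2d_1+b_8^2c_1)y^2t^2+(b_1^2d_2+b_4^2c_2)z^2t^2$$ $$+b_7(b_2b_6+b_3b_8)x^2yz+b_3(b_1b_5+b_4b_7)x^2zt+b_8(b_2b_7+b_3b_5)xy^2t+b_2(b_1b_8+b_4b_6)y^2zt$$ $$+b_1(b_2b_6+b_3b_8)xyz^2+b_6(b_1b_5+b_4b_7)xz^2t+b_4(b_2b_7+b_3b_5)xyt^2+b_5(b_1b_8+b_4b_6)yzt^2=0.$$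
   Context: $k$ is an algebraically closed field of characteristic $2$. $\mathbf P^5$ has homogeneous coordinates $(X_1,X_2,X_3,Y_1,Y_2,Y_3)$ and $\mathbf P^3$ has homogeneous coordinates $(x,y,z,t)$. $G=\{\sum_{i=1}^3X_iY_i=0\}\subset\mathbf P^5$ is identified with the Grassmannian $G(2,4)$ of lines in $\mathbf P^3$ by the Plücker embedding: the line through $(x,y,z,t)$ and $(x',y',z',t')$ has coordinates $X_1=xt'+tx'$, $X_2=xz'+zx'$, $X_3=xy'+yx'$, $Y_1=yz'+zy'$, $Y_2=yt'+ty'$, $Y_3=zt'+tz'$. Three kinds of second quadrics are considered, with all constants in $k$: (a) $Q:\ \sum_{i=1}^3(a_iX_iY_i+c_iX_i^2+d_iY_i^2)=0$ with $a_1,a_2,a_3$ pairwise distinct; (b) $Q_1:\ \sum_{i=1}^3(a_iX_iY_i+c_iX_i^2+d_iY_i^2)+b_1X_2Y_3+b_2X_3Y_2+b_3X_2X_3+b_4Y_2Y_3=0$ with $a_1\neq a_2=a_3$; (c) $Q_0:\ \sum_{i=1}^3(aX_iY_i+c_iX_i^2+d_iY_i^2)+b_1X_2Y_3+b_2X_3Y_2+b_3X_2X_3+b_4Y_2Y_3+b_5X_1Y_2+b_6X_2Y_1+b_7X_1X_2+b_8Y_1Y_2=0$. In (b) and (c) there are $\alpha_i,\beta_i,\gamma_i,\delta_i\in k$ $(i=1,2,3)$ with $\alpha_i\delta_i+\beta_i\gamma_i=1$ such that $b_1=\beta_3\gamma_2$, $b_2=\alpha_2\delta_3$, $b_3=\gamma_2\delta_3$,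 $b_4=\alpha_2\beta_3$ and (in case (c)) $b_5=\beta_2\gamma_1$, $b_6=\alpha_1\delta_2$, $b_7=\gamma_1\delta_2$, $b_8=\alpha_1\beta_2$. In particular $b_1b_2=b_3b_4$ and $b_5b_6=b_7b_8$. $\mathcal X=G\cap Q$, $\mathcal X_1=G\cap Q_1$, $\mathcal X_0=G\cap Q_0$ are assumed non-singular (each then contains no plane). For $\mathfrak p\in\mathbf P^3$, $\sigma(\mathfrak p)\subset G$ denotes the plane of all lines through $\mathfrak p$. A line corresponding to $u\in\mathcal X$ is singular if $u$ is a singular point of the conic $\sigma(\mathfrak p)\cap Q$ for some $\mathfrak p$, and $\mathfrak p$ is then its focus. Thus the set of foci is $S=\{\mathfrak p\in\mathbf P^3:\ \sigma(\mathfrak p)\cap Q\text{ is a singular conic}\}$ (double lines count as singular conics), and $S_1$, $S_0$ are defined in the same way with $Q_1$, $Q_0$ in place of $Q$. *)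

(* Defs.v *)
From HB Require Import structures.
From mathcomp Require Import all_boot all_order all_algebra.
From mathcomp Require Import mpoly.

Set Implicit Arguments.
Unset Strict Implicit.
Unset Printing Implicit Defensive.

Import GRing.Theory.
Local Open Scope ring_scope.

(* A point of P^n is given by homogeneous coordinates, i.e. by a nonzero row  *)
(* vector of size n+1; a subset of P^n is a predicate used on such vectors.   *)
(* P^3 has coordinates (x, y, z, t), P^5 has (X1, X2, X3, Y1, Y2, Y3).        *)

Local Notation X1 := 'X_(@inord 5 0).
Local Notation X2 := 'X_(@inord 5 1).
Local Notation X3 := 'X_(@inord 5 2).
Local Notation Y1 := 'X_(@inord 5 3).
Local Notation Y2 := 'X_(@inord 5 4).
Local Notation Y3 := 'X_(@inord 5 5).

Definition G (k : fieldType) : {mpoly k[6]} := X1 * Y1 + X2 * Y2 + X3 * Y3.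

Definition gradient (k : fieldType) (n : nat) (f : {mpoly k[n]})
    (u : 'rV[k]_n) : 'rV[k]_n :=
  \row_j (f^`M(j)).@[u 0].

(* Jacobian criterion: the scheme f = g = 0 in P^n is smooth of codimension 2 *)
(* at each of its points.                                                     *)
Definition nonsingular_intersection (k : fieldType) (n : nat)
    (f g : {mpoly k[n.+1]}) : Prop :=
  forall u : 'rV[k]_n.+1, u != 0 -> f.@[u 0] = 0 -> g.@[u 0] = 0 ->
    \rank (col_mx (gradient f u) (gradient g u)) = 2%N.

(* Signs are those of characteristic 2. *)
Definition plucker (k : fieldType) (p p' : 'rV[k]_4) : 'rV[k]_6 :=
  let x := p 0 (inord 0) in let x' := p' 0 (inord 0) in
  let y := p 0 (inord 1) in let y' := p' 0 (inord 1) in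
  let z := p 0 (inord 2) in let z' := p' 0 (inord 2) in
  let t := p 0 (inord 3) in let t' := p' 0 (inord 3) in
  \row_(i < 6) [:: x * t' + t * x'; x * z' + z * x'; x * y' + y * x';
                   y * z' + z * y'; y * t' + t * y'; z * t' + t * z']`_i.

(* The points of the plane of lines through p. Rescaling p' rescales u, so    *)
(* all homogeneous coordinates of each such line are obtained, and u is       *)
(* nonzero because p and p' are distinct points.                              *)
Definition sigma (k : fieldType) (p : 'rV[k]_4) (u : 'rV[k]_6) : Prop :=
  exists2 p' : 'rV[k]_4, \rank (col_mx p p') = 2%N & u = plucker p p'.

(* The plane sigma p is not contained in the quadric q = 0. *)
Definition conic_section (k : fieldType) (q : {mpoly k[6]})
    (p : 'rV[k]_4) : Prop :=
  exists2 u, sigma p u & q.@[u 0] != 0.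

(* The line u is a singular point of the conic cut out on sigma p by q = 0:   *)
(* it lies on it, and the differential of q at u vanishes along sigma p.      *)
Definition singular_point (k : fieldType) (q : {mpoly k[6]})
    (p : 'rV[k]_4) (u : 'rV[k]_6) : Prop :=
  [/\ sigma p u, q.@[u 0] = 0
    & forall v, sigma p v -> gradient q u *m v^T = 0].

Definition foci (k : fieldType) (q : {mpoly k[6]}) (p : 'rV[k]_4) : Prop :=
  conic_section q p /\ exists u, singular_point q p u.

Definition surface_with_equation (k : fieldType) (S : 'rV[k]_4 -> Prop)
    (F : {mpoly k[4]}) : Prop :=
  F != 0 /\ forall p : 'rV[k]_4, p != 0 -> S p <-> F.@[p 0] = 0.

Definition quadric (k : fieldType) (a1 a2 a3 c1 c2 c3 d1 d2 d3 : k) :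
    {mpoly k[6]} :=
  a1 *: (X1 * Y1) + c1 *: X1 ^+ 2 + d1 *: Y1 ^+ 2
  + (a2 *: (X2 * Y2) + c2 *: X2 ^+ 2 + d2 *: Y2 ^+ 2)
  + (a3 *: (X3 * Y3) + c3 *: X3 ^+ 2 + d3 *: Y3 ^+ 2).

Definition quadric1 (k : fieldType) (a1 a2 a3 c1 c2 c3 d1 d2 d3 : k)
    (b1 b2 b3 b4 : k) : {mpoly k[6]} :=
  quadric a1 a2 a3 c1 c2 c3 d1 d2 d3
  + b1 *: (X2 * Y3) + b2 *: (X3 * Y2) + b3 *: (X2 * X3) + b4 *: (Y2 * Y3).

Definition quadric0 (k : fieldType) (a c1 c2 c3 d1 d2 d3 : k)
    (b1 b2 b3 b4 b5 b6 b7 b8 : k) : {mpoly k[6]} :=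
  quadric1 a a a c1 c2 c3 d1 d2 d3 b1 b2 b3 b4
  + b5 *: (X1 * Y2) + b6 *: (X2 * Y1) + b7 *: (X1 * X2) + b8 *: (Y1 * Y2).

Local Notation x := 'X_(@inord 3 0).
Local Notation y := 'X_(@inord 3 1).
Local Notation z := 'X_(@inord 3 2).
Local Notation t := 'X_(@inord 3 3).

Definition quartic (k : fieldType) (a1 a2 a3 c1 c2 c3 d1 d2 d3 : k) :
    {mpoly k[4]} :=
  (a1 + a2) ^+ 2 *: (c3 *: (x ^+ 2 * y ^+ 2) + d3 *: (z ^+ 2 * t ^+ 2))
  + (a1 + a3) ^+ 2 *: (c2 *: (x ^+ 2 * z ^+ 2) + d2 *: (y ^+ 2 * t ^+ 2))
  + (a2 + a3) ^+ 2 *: (c1 *: (x ^+ 2 * t ^+ 2) + d1 *: (y ^+ 2 * z ^+ 2))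
  + ((a1 + a2) * (a2 + a3) * (a3 + a1)) *: (x * y * z * t).

Definition quartic1 (k : fieldType) (a1 a2 c1 c2 c3 d1 d2 d3 : k)
    (b1 b2 b3 b4 : k) : {mpoly k[4]} :=
  (b3 ^+ 2 * c1) *: x ^+ 4 + (b2 ^+ 2 * d1) *: y ^+ 4
  + (b1 ^+ 2 * d1) *: z ^+ 4 + (b4 ^+ 2 * c1) *: t ^+ 4
  + (b3 ^+ 2 * d2 + b2 ^+ 2 * c2 + (a1 + a2) ^+ 2 * c3
     + (a1 + a2) * b2 * b3) *: (x ^+ 2 * y ^+ 2)
  + (b3 ^+ 2 * d3 + b1 ^+ 2 * c3 + (a1 + a2) ^+ 2 * c2
     + (a1 + a2) * b1 * b3) *: (x ^+ 2 * z ^+ 2)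
  + (b2 ^+ 2 * d3 + b4 ^+ 2 * c3 + (a1 + a2) ^+ 2 * d2
     + (a1 + a2) * b2 * b4) *: (y ^+ 2 * t ^+ 2)
  + (b1 ^+ 2 * d2 + b4 ^+ 2 * c2 + (a1 + a2) ^+ 2 * d3
     + (a1 + a2) * b1 * b4) *: (z ^+ 2 * t ^+ 2)
  + (a1 + a2) ^+ 2 *: (b3 *: (x ^+ 2 * y * z) + b2 *: (x * y ^+ 2 * t)
                       + b1 *: (x * z ^+ 2 * t) + b4 *: (y * z * t ^+ 2)).

Definition quartic0 (k : fieldType) (c1 c2 c3 d1 d2 d3 : k)
    (b1 b2 b3 b4 b5 b6 b7 b8 : k) : {mpoly k[4]} :=
  (b3 ^+ 2 * c1 + b7 ^+ 2 * c3) *: x ^+ 4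
  + (b2 ^+ 2 * d1 + b8 ^+ 2 * c3) *: y ^+ 4
  + (b1 ^+ 2 * d1 + b6 ^+ 2 * d3) *: z ^+ 4
  + (b4 ^+ 2 * c1 + b5 ^+ 2 * d3) *: t ^+ 4
  + (b5 * (b1 * b5 + b4 * b7)) *: (x * t ^+ 3)
  + (b7 * (b2 * b7 + b3 * b5)) *: (x ^+ 3 * t)
  + (b2 * (b2 * b6 + b3 * b8)) *: (x * y ^+ 3)
  + (b8 * (b2 * b6 + b3 * b8)) *: (y ^+ 3 * z)
  + (b3 * (b2 * b7 + b3 * b5)) *: (x ^+ 3 * y)
  + (b4 * (b1 * b5 + b4 * b7)) *: (z * t ^+ 3)
  + (b6 * (b1 * b8 + b4 * b6)) *: (y * z ^+ 3)
  + (b1 * (b1 * b8 + b4 * b6)) *: (z ^+ 3 * t)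
  + (b2 ^+ 2 * c2 + b3 ^+ 2 * d2) *: (x ^+ 2 * y ^+ 2)
  + (b1 ^+ 2 * c3 + b3 ^+ 2 * d3 + b6 ^+ 2 * c1 + b7 ^+ 2 * d1)
      *: (x ^+ 2 * z ^+ 2)
  + (b5 ^+ 2 * c2 + b7 ^+ 2 * d2) *: (x ^+ 2 * t ^+ 2)
  + (b6 ^+ 2 * d2 + b8 ^+ 2 * c2) *: (y ^+ 2 * z ^+ 2)
  + (b2 ^+ 2 * d3 + b4 ^+ 2 * c3 + b5 ^+ 2 * d1 + b8 ^+ 2 * c1)
      *: (y ^+ 2 * t ^+ 2)
  + (b1 ^+ 2 * d2 + b4 ^+ 2 * c2) *: (z ^+ 2 * t ^+ 2)
  + (b7 * (b2 * b6 + b3 * b8)) *: (x ^+ 2 * y * z)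
  + (b3 * (b1 * b5 + b4 * b7)) *: (x ^+ 2 * z * t)
  + (b8 * (b2 * b7 + b3 * b5)) *: (x * y ^+ 2 * t)
  + (b2 * (b1 * b8 + b4 * b6)) *: (y ^+ 2 * z * t)
  + (b1 * (b2 * b6 + b3 * b8)) *: (x * y * z ^+ 2)
  + (b6 * (b1 * b5 + b4 * b7)) *: (x * z ^+ 2 * t)
  + (b4 * (b2 * b7 + b3 * b5)) *: (x * y * t ^+ 2)
  + (b5 * (b1 * b8 + b4 * b6)) *: (y * z * t ^+ 2).

(* Main.v *)
(* Polarity with respect to G turns the polar form of Q into an endomorphism
   of the space of bivectors; in characteristic 2 it has the form
   p /\ w |-> p /\ wL + pL /\ w + c (p /\ w) for a 4 x 4 matrix L with entries
   a_i + a_j and b_i.  Hence Q restricted to the plane sigma(p) has the polar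
   form (p /\ v, p /\ w) |-> det (p, pL, v, w), whose kernel is spanned by the
   line p /\ pL when p is not an eigenvector of L, and which vanishes
   otherwise; in the latter case the conic is a double line.  So p is a focus
   iff Q vanishes on p /\ pL, and expanding this quartic in p gives the three
   equations.
   Non-singularity says that Q does not vanish at a line which is an
   eigenvector of the endomorphism.  Such lines exist in sigma(p) if p is an
   eigenvector of L, so Q never contains sigma(p); and p /\ pL is such a line
   when p and pL span an L-stable plane, which occurs for some p because L is
   not scalar, so the quartic is not identically zero. *)
From HB Require Import structures.
Require Import Defs.
From mathcomp Require Import all_boot all_order all_algebra.
From mathcomp Require Import mpoly.
From mathcomp Require Import ring.

Import GRing.Theory.
Local Open Scope ring_scope.

Lemma sub_row_eq {F : fieldType} {n : nat} (u v : 'rV[F]_n) :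
  (u <= v)%MS -> exists c, u = c *: v.
Proof. by move/sub_rVP. Qed.

(** * Eigenvectors and stable planes over an algebraically closed field *)

Section Eigenvectors.
Context {k : closedFieldType}.

Lemma exists_eigenvalue (n : nat) (A : 'M[k]_n) :
  (0 < n)%N -> exists a, eigenvalue A a.
Proof.
move=> n_gt0; have /closed_rootP[a]: size (char_poly A) != 1.
  by rewrite size_char_poly eqSS -lt0n.
by rewrite -eigenvalue_root_char; exists a.
Qed.

(** In the basis [row_base U], the restriction of [A] to the stable row space is a square matrix,
    which has an eigenvector. With [U = A] this gives an eigenvector in the image of [A]. *)
Lemma stable_eigenvector (m n : nat) (U : 'M[k]_(m, n)) (A : 'M_n) :
  U != 0 -> (U *m A <= U)%MS ->
  exists (x : 'rV_m) (mu : k), x *m U != 0 /\ x *m U *m A = mu *: (x *m U).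
Proof.
move=> U0 sUA; have rU : (0 < \rank U)%N by rewrite lt0n mxrank_eq0.
have /submxP[A' eA] : (row_base U *m A <= row_base U)%MS.
  by rewrite (eqmxMr A (eq_row_base U)) eq_row_base.
have [mu /eigenvalueP[y yA y0]] := exists_eigenvalue _ A' rU.
have /submxP[x ex] : (y *m row_base U <= U)%MS.
  by rewrite -(eq_row_base U) submxMl.
exists x, mu; rewrite -ex; split.
  apply: contraNneq y0 => y0; apply/eqP/(row_free_inj (row_base_free U)).
  by rewrite y0 mul0mx.
by rewrite -mulmxA eA mulmxA yA scalemxAl.
Qed.

(* Eigenvector of the endomorphism induced by M on k^n / <p>. *)
Lemma quotient_eigenvector (n : nat) (M : 'M[k]_n) (p : 'rV_n) (l : k) :
  (1 < n)%N -> p != 0 -> p *m M = l *: p ->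
  exists (w : 'rV_n) (mu nu : k), ~~ (w <= p)%MS /\ w *m M = mu *: w + nu *: p.
Proof.
move=> n_gt1 p0 pM; pose N := M - l%:M.
have NE (w : 'rV_n) : w *m M = l *: w + w *m N.
  by rewrite mulmxBr mul_mx_scalar addrC subrK.
have pN : p *m N = 0 by apply: (addrI (l *: p)); rewrite -NE addr0.
have [N0|N0] := eqVneq N 0.
  have /row_subPn[i ip] : ~~ ((1%:M : 'M[k]_n) <= p)%MS.
    apply/negP => /mxrankS; rewrite mxrank1 => h.
    by have := leq_trans n_gt1 (leq_trans h (rank_leq_row p)).
  by exists (row i 1%:M), l, 0; split=> //; rewrite NE N0 mulmx0 scale0r.
have [x [mu [w0 wN]]] := stable_eigenvector _ _ N N N0 (submxMl N N).
(* An eigenvector of [N] outside the span of [p] is one of [M]. If it is s p instead, its preimage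
   [x] is an eigenvector modulo [p]. *)
have [/sub_row_eq[s ws]|wp] := boolP (x *m N <= p)%MS; last first.
  by exists (x *m N), (l + mu), 0; rewrite NE wN scale0r addr0 -scalerDl.
exists x, l, s; split; last by rewrite NE ws.
apply: contraNN w0 => /sub_row_eq[r ->].
by rewrite -scalemxAl pN scaler0.
Qed.

(** Take an eigenvector w = xN in the image of N = M - l. If its eigenvalue is 0, x and w span a
    plane on which M is a Jordan block; otherwise p and w have distinct eigenvalues under M and p +
    w generates their span. In both cases [al] and [be] come from the characteristic polynomial of M
    on the plane. *)
Lemma nonscalar_stable_plane (n : nat) (M : 'M[k]_n) :
  (0 < n)%N -> (forall c, M != c%:M) ->
  exists (v : 'rV_n) (al be : k), ~~ (v *m M <= v)%MS
    /\ v *m M *m M = al *: v + be *: (v *m M).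
Proof.
move=> n_gt0 nsM; have [l /eigenvalueP[p pM p0]] := exists_eigenvalue _ M n_gt0.
pose N := M - l%:M.
have NE (w : 'rV_n) : w *m M = l *: w + w *m N.
  by rewrite mulmxBr mul_mx_scalar addrC subrK.
have pN : p *m N = 0 by apply: (addrI (l *: p)); rewrite -NE addr0.
have N0 : N != 0 by rewrite subr_eq0.
have [x [mu [w0 wN]]] := stable_eigenvector _ _ N N N0 (submxMl N N).
set w := x *m N in w0 wN.
have wM : w *m M = (l + mu) *: w by rewrite NE wN scalerDl.
have [mu0|mu0] := eqVneq mu 0.
  have xM : x *m M = l *: x + w by rewrite NE.
  exists x, (- l ^+ 2), (l + l); split; last first.
    rewrite !xM mulmxDl -scalemxAl xM wM mu0 addr0.
    by apply/rowP => i; rewrite !mxE; ring.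
  apply: contraNN w0; rewrite xM => /sub_row_eq[s xs].
  have ws : w = (s - l) *: x by rewrite scalerBl -xs addrC addKr.
  have := wN; rewrite {1}ws -scalemxAl -/w mu0 scale0r => /eqP.
  by rewrite scaler_eq0 => /orP[/eqP s0|//]; rewrite ws s0 scale0r.
exists (p + w), (- (l * (l + mu))), (l + (l + mu)); split; last first.
  rewrite !mulmxDl pM wM -!scalemxAl pM wM.
  by apply/rowP => i; rewrite !mxE; ring.
clearbody w; apply/negP => /sub_row_eq[s]; rewrite mulmxDl pM wM => e.
have {}e : (l - s) *: p = (s - l - mu) *: w.
  apply/rowP => i; move/rowP/(_ i): e; rewrite !mxE => e.
  by apply/eqP; rewrite -subr_eq0 -(subrr (s * (p 0 i + w 0 i))) -{1}e;
    apply/eqP; ring.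
(* [N] kills [p] and scales [w] by [mu], which forces s = l + mu and then s = l. *)
have : (s - l - mu) *: w *m N = 0 by rewrite -e -scalemxAl pN scaler0.
move/eqP; rewrite -scalemxAl wN !scaler_eq0 (negPf mu0) (negPf w0) !orbF.
move=> /eqP s0; move/eqP: e; rewrite s0 scale0r scaler_eq0 (negPf p0) orbF.
move=> /eqP ls; case/eqP: mu0; have -> : mu = - (l - s) - (s - l - mu) by ring.
by rewrite ls s0 oppr0 addr0.
Qed.
End Eigenvectors.

(** * Coordinates of vectors of length 4 and 6 *)

Lemma big_inord (n : nat) (V : nmodType) (f : 'I_n.+1 -> V) :
  \sum_i f i = \sum_(0 <= i < n.+1) f (inord i).
Proof. by rewrite big_mkord; apply: eq_bigr => i _; rewrite inord_val. Qed.

Lemma sum4E (V : nmodType) (f : 'I_4 -> V) :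
  \sum_i f i = f (inord 0) + f (inord 1) + f (inord 2) + f (inord 3).
Proof. by rewrite big_inord unlock /= addr0 !addrA. Qed.

Lemma sum6E (V : nmodType) (f : 'I_6 -> V) :
  \sum_i f i = f (inord 0) + f (inord 1) + f (inord 2)
               + f (inord 3) + f (inord 4) + f (inord 5).
Proof. by rewrite big_inord unlock /= addr0 !addrA. Qed.

Lemma forall_inord (n : nat) (P : 'I_n.+1 -> Prop) :
  (forall i, (i < n.+1)%N -> P (inord i)) -> forall i, P i.
Proof. by move=> h i; rewrite -(inord_val i); apply: h. Qed.

Lemma forall_ord4 (P : 'I_4 -> Prop) :
  P (inord 0) -> P (inord 1) -> P (inord 2) -> P (inord 3) -> forall i, P i.
Proof. by move=> *; apply: forall_inord => [[|[|[|[]]]]]. Qed.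

Lemma forall_ord6 (P : 'I_6 -> Prop) :
  P (inord 0) -> P (inord 1) -> P (inord 2) -> P (inord 3) ->
  P (inord 4) -> P (inord 5) -> forall i, P i.
Proof. by move=> *; apply: forall_inord => [[|[|[|[|[|[]]]]]]]. Qed.

(** * Arithmetic in characteristic 2 *)

Section CharTwo.
Context {R : nzRingType} (char2 : 2%N \in [pchar R]).

Lemma pchar2_even (n : nat) : ~~ odd n -> n%:R = 0 :> R.
Proof. by rewrite -dvdn2 => n2; apply/eqP; rewrite -(dvdn_pcharf char2). Qed.

Lemma pchar2_odd (n : nat) : odd n -> n%:R = 1 :> R.
Proof.
by case: n => //= n n2; rewrite -natr1 (pchar2_even n n2) add0r.
Qed.

End CharTwo.

(* [ring] works with integer coefficients; these equations reduce mod 2 the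
   coefficients that occur below. *)
Ltac char2_ring h :=
  ring: (pchar2_even h 2 isT) (pchar2_odd h 3 isT) (pchar2_even h 4 isT)
        (pchar2_odd h 5 isT) (pchar2_even h 6 isT) (pchar2_odd h 7 isT)
        (pchar2_even h 8 isT) (pchar2_even h 10 isT) (pchar2_even h 12 isT)
        (oppr_pchar2 h 1).

Lemma rowDZE {R : pzRingType} {n : nat} (i : 'I_n) :
  (forall (u v : 'rV[R]_n), (u + v) 0 i = u 0 i + v 0 i)
  * (forall c (u : 'rV[R]_n), (c *: u) 0 i = c * u 0 i).
Proof. by split=> *; rewrite !mxE. Qed.

(** * Plucker coordinates and the polar form of the Klein quadric *)

Section Plucker.
Context {k : fieldType} (char2 : 2%N \in [pchar k]).
Implicit Types (p w m : 'rV[k]_4) (u v : 'rV[k]_6).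

Lemma pluckerE p w :
  let x i := p 0 (inord i) in let y i := w 0 (inord i) in
  (plucker p w 0 (inord 0) = x 0%N * y 3%N + x 3%N * y 0%N)
  * (plucker p w 0 (inord 1) = x 0%N * y 2%N + x 2%N * y 0%N)
  * (plucker p w 0 (inord 2) = x 0%N * y 1%N + x 1%N * y 0%N)
  * (plucker p w 0 (inord 3) = x 1%N * y 2%N + x 2%N * y 1%N)
  * (plucker p w 0 (inord 4) = x 1%N * y 3%N + x 3%N * y 1%N)
  * (plucker p w 0 (inord 5) = x 2%N * y 3%N + x 3%N * y 2%N).
Proof. by rewrite /= !mxE !inordK. Qed.

Fact plucker_is_linear p : linear (plucker p).
Proof.
by move=> c v w; apply/rowP; apply: forall_ord6; rewrite !mxE !inordK //=; ring.
Qed.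
HB.instance Definition _ p :=
  GRing.isLinear.Build k 'rV[k]_4 'rV[k]_6 _ (plucker p) (plucker_is_linear p).



Lemma pluckerC p w : plucker p w = plucker w p.
Proof. by apply/rowP; apply: forall_ord6; rewrite !pluckerE; ring. Qed.

Lemma mderivU (n : nat) (i j : 'I_n) :
  ('X_i : {mpoly k[n]})^`M(j) = (i == j)%:R.
Proof.
rewrite mderivX mnm1E; case: eqVneq => [->|_]; last by rewrite scale0r.
by rewrite scale1r (_ : (_ - _)%MM = 0%MM) ?mpolyX0 //; apply/mnmP => l;
  rewrite mnmBE mnm0E subnn.
Qed.

Lemma eq_inord (n i j : nat) : (i < n.+1)%N -> (j < n.+1)%N ->
  (inord i == inord j :> 'I_n.+1) = (i == j).
Proof. by move=> i_lt j_lt; rewrite -val_eqE /= !inordK. Qed.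

Lemma meval_G u : (G k).@[u 0] =
  u 0 (inord 0) * u 0 (inord 3) + u 0 (inord 1) * u 0 (inord 4)
  + u 0 (inord 2) * u 0 (inord 5).
Proof. by rewrite !(mevalD, mevalM, mevalXU). Qed.

Lemma gradient_GE u :
  let g := gradient (G k) u in
  (g 0 (inord 0) = u 0 (inord 3)) * (g 0 (inord 1) = u 0 (inord 4))
  * (g 0 (inord 2) = u 0 (inord 5)) * (g 0 (inord 3) = u 0 (inord 0))
  * (g 0 (inord 4) = u 0 (inord 1)) * (g 0 (inord 5) = u 0 (inord 2)).
Proof.
rewrite /= !mxE !(mderivD, mderivM, mderivU) !eq_inord //=.
rewrite !(mevalD, mevalM, mevalXU, meval1, meval0).
by rewrite !(mul0r, mulr0, mul1r, mulr1, add0r, addr0).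
Qed.

Lemma gradient_GZ c u : gradient (G k) (c *: u) = c *: gradient (G k) u.
Proof. by apply/rowP; apply: forall_ord6; rewrite !(rowDZE, gradient_GE). Qed.

(** The polar form of [G]: on [plucker p a] and [plucker w v] it is det (p, a, w, v), which is zero
    iff the two lines meet. *)
Definition incidence u v : k := (gradient (G k) u *m v^T) 0 0.

Lemma incidenceE u v : incidence u v =
  u 0 (inord 3) * v 0 (inord 0) + u 0 (inord 4) * v 0 (inord 1)
  + u 0 (inord 5) * v 0 (inord 2) + u 0 (inord 0) * v 0 (inord 3)
  + u 0 (inord 1) * v 0 (inord 4) + u 0 (inord 2) * v 0 (inord 5).
Proof.
have vT j : v^T j 0 = v 0 j by rewrite mxE.
by rewrite /incidence mxE sum6E !vT !gradient_GE.
Qed.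


Lemma incidenceDl u u' v :
  incidence (u + u') v = incidence u v + incidence u' v.
Proof. by rewrite !incidenceE !rowDZE; ring. Qed.

Lemma incidenceZl c u v : incidence (c *: u) v = c * incidence u v.
Proof. by rewrite !incidenceE !rowDZE; ring. Qed.

(** Pairing with the basis bivector on the complementary pair of indices picks out any chosen
    coordinate of [u]. *)
Lemma incidence_nondegenerate u :
  u != 0 -> exists w m, incidence u (plucker w m) != 0.
Proof.
case/rV0Pn; pose e i : 'rV[k]_4 := delta_mx 0 (inord i).
have eE i j : (i < 4)%N -> (j < 4)%N -> e i 0 (inord j) = (j == i)%:R.
  by move=> i4 j4; rewrite /e mxE eqxx eq_inord.
apply: forall_ord6 => ui;
  [exists (e 1%N), (e 2%N) | exists (e 1%N), (e 3%N) | exists (e 2%N), (e 3%N)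
  |exists (e 0%N), (e 3%N) | exists (e 0%N), (e 2%N) | exists (e 0%N), (e 1%N)];
  by rewrite incidenceE !pluckerE !eE //= !(mulr0, mul0r, addr0, add0r, mulr1).
Qed.

Lemma plucker_eq0 p w : p != 0 -> plucker p w = 0 -> (w <= p)%MS.
Proof.
move=> /rV0Pn[i pi] /rowP e; apply/sub_rVP; exists (w 0 i / p 0 i).
have pw : forall i j, p 0 i * w 0 j = p 0 j * w 0 i.
  have sum0 (x y : k) : x + y = 0 -> x = y.
    by move/addr0_eq => <-; rewrite oppr_pchar2.
  move: (e (inord 0)) (e (inord 1)) (e (inord 2)).
  move: (e (inord 3)) (e (inord 4)) (e (inord 5)).
  have z0 j : (0 : 'rV[k]_6) 0 j = 0 by rewrite mxE.
  rewrite !pluckerE !z0 => /sum0 e5 /sum0 e4 /sum0 e3.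
  move=> /sum0 e2 /sum0 e1 /sum0 e0.
  by apply: forall_ord4; apply: forall_ord4.
by apply/rowP => j; rewrite mxE mulrAC [w 0 i * _]mulrC -pw mulrAC mulfV ?mul1r.
Qed.

(** Cramer's relation between the five vectors p, a, m, w, v of k^4, wedged with p so that the term
    in p drops out. *)
Lemma plucker_exchange p a m w (v : 'rV[k]_4) :
  incidence (plucker p a) (plucker w v) *: plucker p m =
  incidence (plucker p m) (plucker w v) *: plucker p a
  + incidence (plucker m a) (plucker p v) *: plucker p w
  + incidence (plucker m a) (plucker p w) *: plucker p v.
Proof.
by apply/rowP; apply: forall_ord6; rewrite !rowDZE !incidenceE !pluckerE;
  char2_ring char2.
Qed.

End Plucker.

(** * The planes sigma(p), and the Jacobian criterion at a line *)

Section Sigma.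
Context {k : fieldType} (char2 : 2%N \in [pchar k]).
Implicit Types (p w m : 'rV[k]_4) (u v : 'rV[k]_6).

Lemma pluckerxx p : plucker p p = 0.
Proof.
by apply/rowP; apply: forall_ord6; rewrite pluckerE mxE; char2_ring char2.
Qed.

Lemma plucker_neq0 p w : p != 0 -> (plucker p w != 0) = ~~ (w <= p)%MS.
Proof.
move=> p0; apply/idP/idP; apply: contraNN.
  case/sub_row_eq=> c ->.
  by rewrite linearZ /= pluckerxx scaler0.
by move/eqP; apply: plucker_eq0.
Qed.

Lemma sigmaP p u : p != 0 ->
  sigma p u <-> u != 0 /\ exists w, u = plucker p w.
Proof.
move=> p0; have rk2 w : (\rank (col_mx p w) = 2%N) <-> ~~ (w <= p)%MS.
  have -> : \rank (col_mx p w) = \rank (p + w)%MS by rewrite addsmxE.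
  have rp : \rank p = 1%N by rewrite rank_rV p0.
  split=> [e|wp].
    by apply/negP => /addsmx_idPl/eqmxP/eqmx_rank; rewrite e rp.
  apply/eqP; rewrite eqn_leq; apply/andP; split.
    by rewrite addsmxE; apply: rank_leq_row.
  have : (\rank p < \rank (p + w)%MS)%N; last by rewrite rp.
  by apply: rank_ltmx; rewrite ltmxE addsmxSl addsmx_sub submx_refl.
split=> [[w /rk2 wp ->]|[u0 [w uE]]]; first by rewrite plucker_neq0 //;
  split=> //; exists w.
by exists w => //; apply/rk2; rewrite -plucker_neq0 // -uE.
Qed.

Lemma incidence_plucker_same p a w :
  incidence (plucker p a) (plucker p w) = 0.
Proof. by rewrite incidenceE !pluckerE; char2_ring char2. Qed.

Lemma meval_G_plucker p w : (G k).@[plucker p w 0] = 0.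
Proof. by rewrite meval_G !pluckerE; char2_ring char2. Qed.

Lemma incidence_plucker_swap m a p w :
  incidence (plucker m a) (plucker p w) = incidence (plucker p m) (plucker a w).
Proof. by rewrite !incidenceE !pluckerE; char2_ring char2. Qed.

(** The second hypothesis says m /\ a /\ p = 0, so m lies in the span of p and a. The exchange
    relation, with w and v chosen so that det (p, a, w, v) is nonzero, gives the factor. *)
Lemma plucker_proportional p a m : plucker p a != 0 ->
  (forall w, incidence (plucker m a) (plucker p w) = 0) ->
  exists c, plucker p m = c *: plucker p a.
Proof.
move=> /incidence_nondegenerate[w [v nz]] vol0.
have := plucker_exchange char2 p a m w v.
rewrite !vol0 !scale0r !addr0 => e.
exists (incidence (plucker p m) (plucker w v)
          / incidence (plucker p a) (plucker w v)).
by apply: (scalerI nz); rewrite e scalerA mulrC divfK.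
Qed.

(** Both gradients are multiples of one vector, so the Jacobian matrix has rank at most 1 at this
    point of [G]. *)
Lemma nonsingular_gradient_colinear (q : {mpoly k[6]}) u c :
  nonsingular_intersection (G k) q -> u != 0 -> (G k).@[u 0] = 0 ->
  gradient q u = c *: gradient (G k) u -> q.@[u 0] != 0.
Proof.
move=> ns u0 Gu qu; apply/negP => /eqP /(ns u u0 Gu) rk2.
have : (\rank (col_mx (gradient (G k) u) (gradient q u)) <= 1)%N.
  have -> : col_mx (gradient (G k) u) (gradient q u)
            = col_mx 1%:M c%:M *m gradient (G k) u.
    by rewrite mul_col_mx mul1mx mul_scalar_mx qu.
  exact: leq_trans (mxrankM_maxr _ _) (rank_leq_row _).
by rewrite rk2.
Qed.

End Sigma.

(** * Foci of a quadric whose polar form is given by a 4 x 4 matrix *)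

Section FocalSurface.
Context {k : closedFieldType} (char2 : 2%N \in [pchar k]).
Context (q : {mpoly k[6]}) (M : 'M[k]_4) (c : k).
Implicit Types (p w m : 'rV[k]_4) (u v : 'rV[k]_6).

(** The first two hypotheses make [q] a quadratic form with its gradient as polar form; the third
    makes [M] the matrix L of the overview. *)
Hypothesis mevalqD : forall u v,
  q.@[(u + v) 0] = q.@[u 0] + q.@[v 0] + (gradient q u *m v^T) 0 0.
Hypothesis mevalqZ : forall s u, q.@[(s *: u) 0] = s ^+ 2 * q.@[u 0].
Hypothesis gradient_plucker : forall p w, gradient q (plucker p w)
  = gradient (G k) (plucker p (w *m M) + plucker (p *m M) w
                    + c *: plucker p w).
Hypothesis nonsing : nonsingular_intersection (G k) q.

(** The terms p /\ aM and c (p /\ a) share the factor p with p /\ w, so only det (pM, a, p, w)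
    survives. *)
Lemma gradient_incidence p a w :
  (gradient q (plucker p a) *m (plucker p w)^T) 0 0 =
  incidence (plucker (p *m M) a) (plucker p w).
Proof.
rewrite gradient_plucker -/(incidence _ _) !incidenceDl incidenceZl.
by rewrite !incidence_plucker_same // mulr0 addr0 add0r.
Qed.

Lemma meval_plucker_eigenline p w mu :
  plucker p w != 0 ->
  plucker p (w *m M) + plucker (p *m M) w = mu *: plucker p w ->
  q.@[plucker p w 0] != 0.
Proof.
move=> pw0 e; apply: (nonsingular_gradient_colinear q _ (mu + c)) => //.
  exact: meval_G_plucker.
by rewrite gradient_plucker e -scalerDl gradient_GZ.
Qed.

Lemma mevalq0 : q.@[(0 : 'rV_6) 0] = 0.
Proof. by rewrite -(scale0r 0) mevalqZ expr0n mul0r. Qed.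

(** If p is an eigenvector of M, a second one modulo p gives an eigenline in sigma(p), where [q] is
    nonzero. Otherwise the polar form is nonzero on some pair, and [q] cannot vanish at both members
    and at their sum. *)
Lemma foci_conic_section p : p != 0 -> conic_section q p.
Proof.
move=> p0; have [/sub_row_eq[l pM]|] := boolP (p *m M <= p)%MS.
  have [//|w [mu [nu [wp wM]]]] := quotient_eigenvector 4 M p l _ p0 pM.
  rewrite -plucker_neq0 // in wp.
  exists (plucker p w); first by apply/sigmaP => //; split=> //; exists w.
  apply: (meval_plucker_eigenline _ _ (mu + l)) => //.
  rewrite wM pM linearD !linearZ /= pluckerxx // scaler0 addr0 scalerDl.
  by rewrite [plucker (_ *: _) _]pluckerC linearZ /= pluckerC.
rewrite -plucker_neq0 // => /incidence_nondegenerate[a [w]].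
rewrite -incidence_plucker_swap // -gradient_incidence => nz.
have sig (v : 'rV[k]_4) : q.@[plucker p v 0] != 0 -> conic_section q p.
  move=> qv; exists (plucker p v) => //; apply/sigmaP => //; split;
    last by exists v.
  by apply: contraNneq qv => ->; rewrite mevalq0.
have [qa|/sig//] := eqVneq q.@[plucker p a 0] 0.
have [qw|/sig//] := eqVneq q.@[plucker p w 0] 0.
by apply: (sig (a + w)); rewrite linearD mevalqD qa qw !add0r.
Qed.

(** A singular point p /\ a is in the kernel of the polar form, so p /\ pM is a multiple of it. *)
Lemma singular_point_focal p u :
  p != 0 -> singular_point q p u -> q.@[plucker p (p *m M) 0] = 0.
Proof.
move=> p0 [/(sigmaP char2 _ _ p0)[u0 [a uE]] qu Bu]; subst u.
have [w|s ->] := plucker_proportional char2 p a (p *m M) u0; last first.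
  by rewrite mevalqZ qu mulr0.
(* The zero bivector is treated apart because [sigma] excludes it. *)
rewrite -gradient_incidence; have [->|pw] := eqVneq (plucker p w) 0.
  by rewrite trmx0 mulmx0 mxE.
by rewrite Bu ?mxE //; apply/sigmaP => //; split=> //; exists w.
Qed.

(** The polar form vanishes on sigma(p), so [q] is additive there; in characteristic 2 over a field
    with square roots it is then the square of a linear form, here given by [S]. *)
Lemma isotropic_singular_point p : p != 0 -> (p *m M <= p)%MS ->
  exists u, singular_point q p u.
Proof.
move=> p0 /sub_row_eq[l pM].
have polar0 a w : (gradient q (plucker p a) *m (plucker p w)^T) 0 0 = 0.
  rewrite gradient_incidence pM pluckerC linearZ /= pluckerC incidenceZl.
  by rewrite incidence_plucker_same // mulr0.
pose f w := q.@[plucker p w 0].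
have fD : {morph f : v w / v + w}.
  by move=> v w; rewrite /f linearD mevalqD polar0 addr0.
have fZ s w : f (s *: w) = s ^+ 2 * f w by rewrite /f linearZ mevalqZ.
have f0 : f 0 = 0 by rewrite /f linear0 mevalq0.
have sqrt x : exists y : k, y ^+ 2 = x.
  have [y ye] := @solve_monicpoly k 2 (fun i => if i == 0%N then x else 0) isT.
  by exists y; rewrite ye !big_ord_recl big_ord0 /= mulr1 mul0r !addr0.
have /fin_all_exists[s sE] : forall i, exists y : k, y ^+ 2 = f (delta_mx 0 i).
  by move=> i; apply: sqrt.
pose S : 'cV[k]_4 := \col_i s i.
have fE w : f w = ((w *m S) 0 0) ^+ 2.
  rewrite {1}(row_sum_delta w) (big_morph f fD f0) mxE.
  have sqD : {morph (fun y : k => y ^+ 2) : x y / x + y}.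
    by move=> x y /=; char2_ring char2.
  rewrite (big_morph _ sqD (expr0n _ 2)); apply: eq_bigr => i _.
  by rewrite fZ -sE mxE exprMn.
(* The kernel of [S] in k^4 has dimension at least 3, so it is not contained in the span of [p]. *)
have /row_subPn[i wp] : ~~ (kermx S <= p)%MS.
  apply/negP => /mxrankS; rewrite mxrank_ker rank_rV p0.
  by have := rank_leq_col S; case: (\rank S) => [|[|]].
set w := row i _ in wp; have wS : w *m S = 0.
  by apply/sub_kermxP; apply: row_sub.
have pw : plucker p w != 0 by rewrite plucker_neq0.
exists (plucker p w); split.
- by apply/sigmaP => //; split=> //; exists w.
- by rewrite -/(f w) fE wS mxE expr0n.
move=> v /(sigmaP char2 _ _ p0)[_ [a ->]]; apply/matrixP => j1 j2;
  rewrite !ord1 polar0.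
by rewrite mxE.
Qed.

(** When p is not an eigenvector, p /\ pM itself is singular, because det (pM, pM, p, a) = 0 for all
    a. *)
Lemma focal_singular_point p : p != 0 -> q.@[plucker p (p *m M) 0] = 0 ->
  exists u, singular_point q p u.
Proof.
move=> p0 Fp; have [/isotropic_singular_point|] := boolP (p *m M <= p)%MS.
  exact.
rewrite -plucker_neq0 // => pM; exists (plucker p (p *m M)); split=> //.
  by apply/sigmaP => //; split=> //; exists (p *m M).
move=> v /(sigmaP char2 _ _ p0)[_ [a ->]]; apply/matrixP => j1 j2.
rewrite !ord1 gradient_incidence mxE incidence_plucker_swap //.
by rewrite incidenceE !(pluckerE); char2_ring char2.
Qed.

Lemma focal_surface (F : {mpoly k[4]}) :
  (forall l, M != l%:M) ->
  (forall p, F.@[p 0] = q.@[plucker p (p *m M) 0]) ->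
  surface_with_equation (foci q) F.
Proof.
move=> nsM FE; split.
  have [//|v [al [be [vM vMM]]]] := nonscalar_stable_plane 4 M _ nsM.
  have v0 : v != 0 by apply: contraNneq vM => ->; rewrite mul0mx.
  have vMn : plucker v (v *m M) != 0 by rewrite plucker_neq0.
  have : q.@[plucker v (v *m M) 0] != 0.
    apply: (meval_plucker_eigenline _ _ be) => //.
    by rewrite vMM linearD !linearZ /= !pluckerxx // scaler0 addr0 add0r.
  by apply: contraNneq => F0; rewrite -FE F0 meval0.
move=> p p0; rewrite FE; split=> [[_ [u]]|Fp].
  exact: singular_point_focal.
by split; [apply: foci_conic_section | apply: focal_singular_point].
Qed.
End FocalSurface.

(** * Gradients of sums, multiples and products of variables *)

Section Gradient.
Context {k : fieldType} {n : nat}.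
Implicit Types (f g : {mpoly k[n]}) (u : 'rV[k]_n).

Lemma gradientD f g u j :
  gradient (f + g) u 0 j = gradient f u 0 j + gradient g u 0 j.
Proof. by rewrite !mxE mderivD mevalD. Qed.

Lemma gradientZ c f u j : gradient (c *: f) u 0 j = c * gradient f u 0 j.
Proof. by rewrite !mxE mderivZ mevalZ. Qed.

Lemma gradientXX u i i' j : gradient ('X_i * 'X_i') u 0 j =
  (i == j)%:R * u 0 i' + (i' == j)%:R * u 0 i.
Proof.
rewrite mxE mderivM mevalD !mevalM !mderivU !mevalXU !rmorph_nat.
by rewrite [u 0 i * _]mulrC.
Qed.

End Gradient.

(** * One family containing the three quadrics *)

Section Family.
Context {k : closedFieldType} (char2 : 2%N \in [pchar k]).
Variables (a1 a2 a3 c1 c2 c3 d1 d2 d3 b1 b2 b3 b4 b5 b6 b7 b8 : k).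
Implicit Types (p w : 'rV[k]_4) (u v : 'rV[k]_6).

(* Abstracting over the products [m i j] of the coordinates [i] and [j] lets
   evaluation and differentiation be pushed through the sum in an abstract
   module; [rewrite] would unfold the operations of {mpoly k[6]} otherwise. *)
Definition quadratic_sum {V : lmodType k} (m : nat -> nat -> V) : V :=
  a1 *: m 0 3 + c1 *: m 0 0 + d1 *: m 3 3
  + (a2 *: m 1 4 + c2 *: m 1 1 + d2 *: m 4 4)
  + (a3 *: m 2 5 + c3 *: m 2 2 + d3 *: m 5 5)
  + b1 *: m 1 5 + b2 *: m 2 4 + b3 *: m 1 2 + b4 *: m 4 5
  + b5 *: m 0 4 + b6 *: m 1 3 + b7 *: m 0 1 + b8 *: m 3 4.

Lemma quadratic_sum_morph {V W : lmodType k} (f : V -> W) m m' :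
  {morph f : x y / x + y} -> (forall c x, f (c *: x) = c *: f x) ->
  (forall i j, f (m i j) = m' i j) -> f (quadratic_sum m) = quadratic_sum m'.
Proof. by move=> fD fZ fm; rewrite /quadratic_sum !fD !fZ !fm. Qed.

Definition complex_quadric : {mpoly k[6]} :=
  quadratic_sum (fun i j => 'X_(inord i) * 'X_(inord j)).

(** The matrix L of the overview, acting on row vectors. Adding a scalar matrix to L does not change
    p /\ wL + pL /\ w in characteristic 2; the scalar is fixed by the zero in the first entry. The
    sum of any two diagonal entries, increased by a1 + a2 + a3, is one of the a_i. *)
Definition focal_entries : seq (seq k) :=
  [:: [:: 0;  b7;      0;       b3];
      [:: b8; a1 + a2; b2;      0];
      [:: 0;  b1;      a1 + a3; b6];
      [:: b4; 0;       b5;      a2 + a3]].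

Definition focal_matrix : 'M[k]_4 :=
  \matrix_(i, j) (nth [::] focal_entries i)`_j.

Lemma focal_matrixE (i j : nat) : (i < 4)%N -> (j < 4)%N ->
  focal_matrix (inord i) (inord j) = (nth [::] focal_entries i)`_j.
Proof. by move=> i4 j4; rewrite mxE !inordK. Qed.

Lemma mul_focal_matrixE p : let x i := p 0 (inord i) in
  let p' := p *m focal_matrix in
  (p' 0 (inord 0) = b8 * x 1%N + b4 * x 3%N)
  * (p' 0 (inord 1) = b7 * x 0%N + (a1 + a2) * x 1%N + b1 * x 2%N)
  * (p' 0 (inord 2) = b2 * x 1%N + (a1 + a3) * x 2%N + b5 * x 3%N)
  * (p' 0 (inord 3) = b3 * x 0%N + b6 * x 2%N + (a2 + a3) * x 3%N).
Proof.
have pME i : (p *m focal_matrix) 0 i =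
    p 0 (inord 0) * focal_matrix (inord 0) i
    + p 0 (inord 1) * focal_matrix (inord 1) i
    + p 0 (inord 2) * focal_matrix (inord 2) i
    + p 0 (inord 3) * focal_matrix (inord 3) i.
  by rewrite mxE sum4E.
by rewrite /= !pME !focal_matrixE //=; do !split; ring.
Qed.

Lemma meval_complex_quadric u : complex_quadric.@[u 0] =
  quadratic_sum (V := k^o) (fun i j => u 0 (inord i) * u 0 (inord j)).
Proof.
apply: (quadratic_sum_morph (W := k^o) (meval (u 0))).
- exact: mevalD.
- exact: mevalZ.
by move=> i j; rewrite mevalM !mevalXU.
Qed.

(** The constants c_i and d_i disappear because squares have zero derivative in characteristic 2. *)
Lemma gradient_complex_quadricE u : let x i := u 0 (inord i) in
  let g := gradient complex_quadric u in
  (g 0 (inord 0) = a1 * x 3%N + b5 * x 4%N + b7 * x 1%N)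
  * (g 0 (inord 1) =
     a2 * x 4%N + b1 * x 5%N + b3 * x 2%N + b6 * x 3%N + b7 * x 0%N)
  * (g 0 (inord 2) = a3 * x 5%N + b2 * x 4%N + b3 * x 1%N)
  * (g 0 (inord 3) = a1 * x 0%N + b6 * x 1%N + b8 * x 4%N)
  * (g 0 (inord 4) =
     a2 * x 1%N + b2 * x 2%N + b4 * x 5%N + b5 * x 0%N + b8 * x 3%N)
  * (g 0 (inord 5) = a3 * x 2%N + b1 * x 1%N + b4 * x 4%N).
Proof.
have gE j : gradient complex_quadric u 0 j = quadratic_sum (V := k^o)
    (fun i i' => (inord i == j)%:R * u 0 (inord i')
                 + (inord i' == j)%:R * u 0 (inord i)).
  apply: (quadratic_sum_morph (W := k^o) (fun f => gradient f u 0 j)).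
  - by move=> f g; rewrite gradientD.
  - by move=> c f; rewrite gradientZ.
  - by move=> i i'; rewrite gradientXX.
rewrite /= !gE /quadratic_sum !eq_inord //= /GRing.scale /=.
by do !split; char2_ring char2.
Qed.

Lemma meval_complex_quadricD u v : complex_quadric.@[(u + v) 0] =
  complex_quadric.@[u 0] + complex_quadric.@[v 0]
  + (gradient complex_quadric u *m v^T) 0 0.
Proof.
have gv : (gradient complex_quadric u *m v^T) 0 0
          = \sum_j gradient complex_quadric u 0 j * v 0 j.
  by rewrite mxE; apply: eq_bigr => j _; rewrite [v^T j 0]mxE.
rewrite gv sum6E !gradient_complex_quadricE.
rewrite !meval_complex_quadric /quadratic_sum !rowDZE /GRing.scale /=;
  char2_ring char2.
Qed.

Lemma meval_complex_quadricZ s u :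
  complex_quadric.@[(s *: u) 0] = s ^+ 2 * complex_quadric.@[u 0].
Proof.
by rewrite !meval_complex_quadric /quadratic_sum !rowDZE /GRing.scale /=; ring.
Qed.

Lemma gradient_complex_quadric_plucker p w :
  gradient complex_quadric (plucker p w) =
  gradient (G k) (plucker p (w *m focal_matrix) + plucker (p *m focal_matrix) w
                  + (a1 + a2 + a3) *: plucker p w).
Proof.
apply/rowP; apply: forall_ord6;
  rewrite gradient_GE gradient_complex_quadricE !rowDZE !pluckerE
          !mul_focal_matrixE; char2_ring char2.
Qed.

Lemma focal_surface_complex_quadric (F : {mpoly k[4]}) :
  nonsingular_intersection (G k) complex_quadric ->
  (exists i j, i != j /\
    (focal_matrix i j != 0 \/ focal_matrix i i != focal_matrix j j)) ->
  (forall p, F.@[p 0] = complex_quadric.@[plucker p (p *m focal_matrix) 0]) ->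
  surface_with_equation (foci complex_quadric) F.
Proof.
move=> ns [i [j [ij nsc]]].
apply: (focal_surface char2 _ _ (a1 + a2 + a3)) => //.
- exact: meval_complex_quadricD.
- exact: meval_complex_quadricZ.
- exact: gradient_complex_quadric_plucker.
move=> l; apply/eqP => e; case: nsc; rewrite e !mxE ?eqxx //.
by rewrite (negPf ij) eqxx.
Qed.

End Family.

(** * The three complexes as members of the family *)

Lemma quadricE (k : closedFieldType) (a1 a2 a3 c1 c2 c3 d1 d2 d3 : k) :
  quadric a1 a2 a3 c1 c2 c3 d1 d2 d3 =
  complex_quadric a1 a2 a3 c1 c2 c3 d1 d2 d3 0 0 0 0 0 0 0 0.
Proof. by rewrite /complex_quadric /quadratic_sum !scale0r 8!addr0. Qed.

Lemma quadric1E (k : closedFieldType)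
    (a1 a2 a3 c1 c2 c3 d1 d2 d3 b1 b2 b3 b4 : k) :
  quadric1 a1 a2 a3 c1 c2 c3 d1 d2 d3 b1 b2 b3 b4 =
  complex_quadric a1 a2 a3 c1 c2 c3 d1 d2 d3 b1 b2 b3 b4 0 0 0 0.
Proof. by rewrite /complex_quadric /quadratic_sum !scale0r 4!addr0. Qed.

Lemma quadric0E (k : closedFieldType)
    (a c1 c2 c3 d1 d2 d3 b1 b2 b3 b4 b5 b6 b7 b8 : k) :
  quadric0 a c1 c2 c3 d1 d2 d3 b1 b2 b3 b4 b5 b6 b7 b8 =
  complex_quadric a a a c1 c2 c3 d1 d2 d3 b1 b2 b3 b4 b5 b6 b7 b8.
Proof. by []. Qed.

Lemma mevalXn (k : comNzRingType) (n m : nat) (v : 'I_n -> k)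
    (f : {mpoly k[n]}) :
  (f ^+ m).@[v] = f.@[v] ^+ m.
Proof. exact: rmorphXn. Qed.

(* Going down the syntax tree: a global [rewrite !mevalD] compares each
   subterm with the pattern up to unfolding, which takes minutes. *)
Ltac push_meval :=
  lazymatch goal with
  | |- meval _ (_ + _) = _ =>
      apply: (etrans (mevalD _ _ _)); apply: (f_equal2 +%R); push_meval
  | |- meval _ (_ *: _) = _ =>
      apply: (etrans (mevalZ _ _ _)); apply: (f_equal ( *%R _)); push_meval
  | |- meval _ (_ * _) = _ =>
      apply: (etrans (mevalM _ _ _)); apply: (f_equal2 *%R); push_meval
  | |- meval _ (_ ^+ ?m) = _ =>
      apply: (etrans (mevalXn _ _ _ _ _)); apply: (f_equal (fun y => y ^+ m));
      push_meval
  | |- _ => exact: mevalXU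
  end.

Theorem theorem1p1 (k : closedFieldType) (char2 : 2%N \in [pchar k]) :
  [/\ forall a1 a2 a3 c1 c2 c3 d1 d2 d3 : k,
        a1 != a2 -> a1 != a3 -> a2 != a3 ->
        nonsingular_intersection (G k)
          (quadric a1 a2 a3 c1 c2 c3 d1 d2 d3) ->
        surface_with_equation
          (foci (quadric a1 a2 a3 c1 c2 c3 d1 d2 d3))
          (quartic a1 a2 a3 c1 c2 c3 d1 d2 d3),
      forall (a1 a2 a3 c1 c2 c3 d1 d2 d3 b1 b2 b3 b4 : k)
             (al1 al2 al3 be1 be2 be3 ga1 ga2 ga3 de1 de2 de3 : k),
        a1 != a2 -> a2 = a3 ->
        al1 * de1 + be1 * ga1 = 1 ->
        al2 * de2 + be2 * ga2 = 1 ->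
        al3 * de3 + be3 * ga3 = 1 ->
        b1 = be3 * ga2 -> b2 = al2 * de3 ->
        b3 = ga2 * de3 -> b4 = al2 * be3 ->
        nonsingular_intersection (G k)
          (quadric1 a1 a2 a3 c1 c2 c3 d1 d2 d3 b1 b2 b3 b4) ->
        surface_with_equation
          (foci (quadric1 a1 a2 a3 c1 c2 c3 d1 d2 d3 b1 b2 b3 b4))
          (quartic1 a1 a2 c1 c2 c3 d1 d2 d3 b1 b2 b3 b4)
    & forall (a c1 c2 c3 d1 d2 d3 b1 b2 b3 b4 b5 b6 b7 b8 : k)
             (al1 al2 al3 be1 be2 be3 ga1 ga2 ga3 de1 de2 de3 : k),
        al1 * de1 + be1 * ga1 = 1 ->
        al2 * de2 + be2 * ga2 = 1 ->
        al3 * de3 + be3 * ga3 = 1 ->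
        b1 = be3 * ga2 -> b2 = al2 * de3 ->
        b3 = ga2 * de3 -> b4 = al2 * be3 ->
        b5 = be2 * ga1 -> b6 = al1 * de2 ->
        b7 = ga1 * de2 -> b8 = al1 * be2 ->
        nonsingular_intersection (G k)
          (quadric0 a c1 c2 c3 d1 d2 d3 b1 b2 b3 b4 b5 b6 b7 b8) ->
        surface_with_equation
          (foci (quadric0 a c1 c2 c3 d1 d2 d3 b1 b2 b3 b4 b5 b6 b7 b8))
          (quartic0 c1 c2 c3 d1 d2 d3 b1 b2 b3 b4 b5 b6 b7 b8)].
Proof.
have add_neq0 (x y : k) : x != y -> x + y != 0.
  by rewrite -subr_eq0 oppr_pchar2.
split.
- move=> a1 a2 a3 c1 c2 c3 d1 d2 d3 a12 _ _; rewrite quadricE => ns.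
  apply: focal_surface_complex_quadric => //.
    (* The first two diagonal entries, 0 and a1 + a2, differ. *)
    exists (inord 0), (inord 1); rewrite eq_inord //; split=> //.
    by right; rewrite !focal_matrixE //= eq_sym add_neq0.
  move=> p; rewrite meval_complex_quadric /quadratic_sum /GRing.scale /=.
  rewrite !pluckerE !mul_focal_matrixE /quartic.
  by eapply etrans; [push_meval | char2_ring char2].
- move=> a1 a2 a3 c1 c2 c3 d1 d2 d3 b1 b2 b3 b4.
  move=> al1 al2 al3 be1 be2 be3 ga1 ga2 ga3 de1 de2 de3 a12 <- _ _ _.
  rewrite quadric1E => b1E b2E b3E b4E ns.
  apply: focal_surface_complex_quadric => //.
    exists (inord 0), (inord 1); rewrite eq_inord //; split=> //.
    by right; rewrite !focal_matrixE //= eq_sym add_neq0.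
  move=> p; rewrite meval_complex_quadric /quadratic_sum /GRing.scale /=.
  rewrite !pluckerE !mul_focal_matrixE !addrr_pchar2 // /quartic1.
  eapply etrans; first push_meval.
  (* The substitution builds in b1 b2 = b3 b4, modulo which the expansion agrees with the
     quartic. *)
  by rewrite b1E b2E b3E b4E; char2_ring char2.
move=> a c1 c2 c3 d1 d2 d3 b1 b2 b3 b4 b5 b6 b7 b8.
move=> al1 al2 al3 be1 be2 be3 ga1 ga2 ga3 de1 de2 de3 _ ag2 ag3.
rewrite quadric0E => b1E b2E b3E b4E b5E b6E b7E b8E ns.
apply: focal_surface_complex_quadric => //.
  (* (al2, ga2) and (be3, de3) are nonzero vectors, so one of their products
     b1, ..., b4 is nonzero. *)
  have nz2 : al2 = 0 -> ga2 != 0.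
    by move=> al0; apply: contra_eq_neq ag2 => ->;
      rewrite al0 mul0r mulr0 addr0 eq_sym oner_eq0.
  have nz3 : de3 = 0 -> be3 != 0.
    by move=> de0; apply: contra_eq_neq ag3 => ->;
      rewrite de0 mul0r mulr0 addr0 eq_sym oner_eq0.
  have [/nz2 ga0|al0] := eqVneq al2 0; have [/nz3 be0|de0] := eqVneq de3 0.
  - exists (inord 2), (inord 1); rewrite eq_inord //; split=> //.
    by left; rewrite !focal_matrixE //= b1E mulf_neq0.
  - exists (inord 0), (inord 3); rewrite eq_inord //; split=> //.
    by left; rewrite !focal_matrixE //= b3E mulf_neq0.
  - exists (inord 3), (inord 0); rewrite eq_inord //; split=> //.
    by left; rewrite !focal_matrixE //= b4E mulf_neq0.
  - exists (inord 1), (inord 2); rewrite eq_inord //; split=> //.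
    by left; rewrite !focal_matrixE //= b2E mulf_neq0.
move=> p; rewrite meval_complex_quadric /quadratic_sum /GRing.scale /=.
rewrite !pluckerE !mul_focal_matrixE !addrr_pchar2 // /quartic0.
eapply etrans; first push_meval.
by rewrite b1E b2E b3E b4E b5E b6E b7E b8E; char2_ring char2.
Qed.
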